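(* Let $\{X_i\}_{i=1}^{\infty}$ be a sequence of random variables of forward factorization on the upper probability space $(\Omega,\mathcal{F},\mathcal{P},\mathbb{V})$. Then $\{X_i\}_{i=1}^{\infty}$ is a sequence of negatively associated random variables.
   Context: Let $(\Omega,\mathcal{F})$ be a measurable space and $\mathcal{P}$ a nonempty set of probability measures on it. For $A\in\mathcal{F}$ set $\mathbb{V}(A)=\sup_{P\in\mathcal{P}}P(A)$. For a random variable $X$ with $E_P[|X|]<\infty$ for all $P\in\mathcal{P}$, set $\mathbb{E}[X]=\sup_{P\in\mathcal{P}}E_P[X]$ and $\mathcal{E}[X]=\inf_{P\in\mathcal{P}}E_P[X]$, where $E_P$ is the classical expectation under $P$. $(\Omega,\mathcal{F},\mathcal{P},\mathbb{V})$ is called the upper probability space. $\{X_i\}_{i=1}^{\infty}$ is a sequence of random variables of forward factorization if for any $n\ge 1$, any bounded (measurable) function $f$ of $X_n$ and any nonnegative bounded (measurable) function $g$ of $X_1,\dots,X_{n-1}$ (a nonnegative constant when $n=1$), one has $\mathcal{E}\big[g(X_1,\dots,X_{n-1})\,(f(X_n)-\mathcal{E}[f(X_n)])\big]\ge 0$. Let $C_b^+(\mathbb{R})$ be the set of nonnegative bounded continuous functions on $\mathbb{R}$. Functions have ''the same monotonicity'' if they are all nondecreasing or all nonincreasing. A sequence $\{X_i\}_{i=1}^{\infty}$ of random variables is negatively associated if for every $n\ge 1$ and every sequence $\{f_i\}_{i=1}^{\infty}\subset C_b^+(\mathbb{R})$ with the same monotonicity, $\mathbb{E}\left[\prod_{i=1}^{n+1}f_i(X_i)\right]\le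 \mathbb{E}\left[\prod_{i=1}^{n}f_i(X_i)\right]\,\mathbb{E}[f_{n+1}(X_{n+1})]$. *)

(* Defs.v *)
From HB Require Import structures.
From mathcomp Require Import all_boot all_order all_algebra.
From mathcomp Require Import all_classical all_reals all_analysis.

Set Implicit Arguments.
Unset Strict Implicit.
Unset Printing Implicit Defensive.
Import Order.TTheory GRing.Theory Num.Theory.
Import numFieldNormedType.Exports.
Local Open Scope classical_set_scope.
Local Open Scope ring_scope.

Definition upper_expectation (d : measure_display) (T : measurableType d)
    (R : realType) (PP : set (probability T R)) (X : T -> R) : \bar R :=
  ereal_sup [set ('E_P[X])%E | P in PP].

Definition lower_expectation (d : measure_display) (T : measurableType d)
    (R : realType) (PP : set (probability T R)) (X : T -> R) : \bar R :=
  ereal_inf [set ('E_P[X])%E | P in PP].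

(* Sequences are indexed from 0, so [X n] is the (n+1)-st variable and its
   predecessors are [X 0] to [X n.-1].  For [n = 0], [g] is defined on the
   one-point type [0.-tuple R], i.e. it is a nonnegative constant.  The lower
   expectation of [f (X n)] is finite because [f] is bounded and [PP] is meant
   to be nonempty; [fine] only casts it back to [R]. *)
Definition forward_factorization (d : measure_display) (T : measurableType d)
    (R : realType) (PP : set (probability T R)) (X : nat -> {mfun T >-> R}) :
    Prop :=
  forall (n : nat) (f : R -> R) (g : n.-tuple R -> R),
    measurable_fun setT f -> bounded_fun f ->
    measurable_fun setT g -> bounded_fun g -> (forall u, 0 <= g u) ->
    (0 <= lower_expectation PP (fun w =>
       (g [tuple X i w | i < n] *
        (f (X n w) - fine (lower_expectation PP (f \o X n))))%R))%E.

Definition Cb_plus (R : realType) : set (R -> R) :=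
  [set f : R -> R | [/\ continuous f, bounded_fun f & forall x, 0 <= f x]].

Definition same_monotonicity (R : realType) (f : nat -> R -> R) : Prop :=
  (forall i, {homo f i : x y / x <= y}) \/
  (forall i, {homo f i : x y /~ x <= y}).

Definition negatively_associated (d : measure_display) (T : measurableType d)
    (R : realType) (PP : set (probability T R)) (X : nat -> {mfun T >-> R}) :
    Prop :=
  forall (n : nat) (f : nat -> R -> R), (1 <= n)%N ->
    (forall i, Cb_plus (f i)) -> same_monotonicity f ->
    (upper_expectation PP (fun w => (\prod_(i < n.+1) f i (X i w))%R) <=
     upper_expectation PP (fun w => (\prod_(i < n) f i (X i w))%R) *
     upper_expectation PP (f n \o X n))%E.

(* Main.v *)
Require Import Defs.
From HB Require Import structures.
From mathcomp Require Import all_boot all_order all_algebra.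
From mathcomp Require Import all_classical all_reals all_analysis.
From mathcomp Require Import measurable_realfun.

Set Implicit Arguments.
Unset Strict Implicit.
Unset Printing Implicit Defensive.
Import Order.TTheory GRing.Theory Num.Theory.
Import numFieldNormedType.Exports.
Local Open Scope classical_set_scope.
Local Open Scope ring_scope.

(** Let [g >= 0] be a bounded function of the past [X 0, ..., X n.-1], let
    [f >= 0] be bounded, and let [M] be the upper expectation of [f (X n)].
    Since upper and lower expectations are exchanged by a change of sign, the
    lower expectation of [- f (X n)] is [- M], so forward factorization applied
    to [g] and [- f] says that [E_P[g * (M - f (X n))] >= 0] under every [P],
    i.e. [E_P[g * f (X n)] <= M * E_P[g]].  As [M >= 0], the right-hand side is
    at most [M] times the upper expectation of [g], and the supremum over [P]
    gives [forward_factorization_upperM].  Negative association is the case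
    where [g] is the product of the earlier [f i] and [f] is the last one. *)

Lemma bounded_funP (U : Type) (R : realType) (h : U -> R) :
  bounded_fun h <-> exists M, forall x, `|h x| <= M.
Proof.
split=> [[M [_ hM]]|[M hM]].
  by exists (M + 1) => x; apply: hM => //; rewrite ltrDl.
by exists M; split=> [|N MN x _]; [exact: num_real | exact: le_trans (ltW MN)].
Qed.

Lemma bounded_funM (U : Type) (R : realType) (h k : U -> R) :
  bounded_fun h -> bounded_fun k -> bounded_fun (fun x => h x * k x).
Proof.
move=> /bounded_funP[M hM] /bounded_funP[N kN]; apply/bounded_funP.
by exists (M * N) => x; rewrite normrM ler_pM.
Qed.

Lemma bounded_fun_prod (U I : Type) (R : realType) (s : seq I)
    (h : I -> U -> R) :
  (forall i, bounded_fun (h i)) -> bounded_fun (fun x => \prod_(i <- s) h i x).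
Proof.
move=> bh; elim: s => [|i s IHs].
  by apply/bounded_funP; exists 1 => x; rewrite big_nil normr1.
rewrite (_ : (fun x => _) = fun x => h i x * \prod_(j <- s) h j x).
  exact: bounded_funM.
by apply/funext => x; rewrite big_cons.
Qed.

Lemma bounded_fun_comp (U V : Type) (R : realType) (h : V -> R) (k : U -> V) :
  bounded_fun h -> bounded_fun (h \o k).
Proof.
by move=> /bounded_funP[M hM]; apply/bounded_funP; exists M => x; exact: hM.
Qed.

Section UpperExpectation.
Context (d : measure_display) (T : measurableType d) (R : realType).
Implicit Types (P : probability T R) (PP : set (probability T R)).
Implicit Types Y : T -> R.

Lemma bounded_Lfun1 P Y :
  measurable_fun setT Y -> bounded_fun Y -> Y \in Lfun P 1.
Proof.
move=> mY bY; apply/Lfun1_integrable; apply: measurable_bounded_integrable => //.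
by rewrite (le_lt_trans (probability_le1 P measurableT)) ?ltry.
Qed.

Lemma expectation_opp P Y : Y \in Lfun P 1 -> ('E_P[\- Y] = - 'E_P[Y])%E.
Proof.
move=> Y1; rewrite -[RHS]mulN1e -expectationZl//.
by congr expectation; apply/funext => x /=; rewrite mulrN1.
Qed.

Lemma lower_expectation_opp PP Y : (forall P, PP P -> Y \in Lfun P 1) ->
  (lower_expectation PP (\- Y)%R = - upper_expectation PP Y)%E.
Proof.
move=> Y1; rewrite /lower_expectation /upper_expectation ereal_infEN.
congr (- ereal_sup _)%E; apply/seteqP; split=> x /=.
- case=> _ [P PPP <-] <-; exists P => //.
  by rewrite expectation_opp ?oppeK//; exact: Y1.
- case=> P PPP <-; exists ('E_P[\- Y])%E; first by exists P.
  by rewrite expectation_opp ?oppeK//; exact: Y1.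
Qed.

Lemma expectation_le_upper PP P Y :
  PP P -> ('E_P[Y] <= upper_expectation PP Y)%E.
Proof. by move=> PPP; apply: ereal_sup_ubound; exists P. Qed.

Lemma upper_expectation_ge0 PP Y : PP !=set0 -> (forall x, 0 <= Y x) ->
  (0 <= upper_expectation PP Y)%E.
Proof.
move=> [P PPP] Y0; apply: le_trans (expectation_le_upper _ PPP).
exact: expectation_ge0.
Qed.

Lemma upper_expectation_fin_num PP Y : PP !=set0 -> measurable_fun setT Y ->
  bounded_fun Y -> (forall x, 0 <= Y x) -> upper_expectation PP Y \is a fin_num.
Proof.
move=> PP0 mY /bounded_funP[M YM] Y0.
rewrite ge0_fin_numE ?upper_expectation_ge0//.
apply: (@le_lt_trans _ _ M%:E); last exact: ltry.
have YleM x : Y x <= M by exact: le_trans (ler_norm _) (YM x).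
apply: ge_ereal_sup => _ [P PPP <-]; rewrite -(expectation_cst P M).
apply: expectation_le => //= [x|]; first exact: le_trans (Y0 x) (YleM x).
exact: aeW.
Qed.

(** Linearity of [E_P] is available because boundedness makes both [Z] and
    [Z * Y] integrable.  With [Z] the past and [M] the upper expectation of [Y],
    the premise is forward factorization read under one measure [P]. *)
Lemma expectationM_le P (Z Y : T -> R) (M : R) :
  measurable_fun setT Z -> bounded_fun Z ->
  measurable_fun setT Y -> bounded_fun Y ->
  (0 <= 'E_P[fun w => (Z w * (M - Y w))%R])%E ->
  ('E_P[fun w => (Z w * Y w)%R] <= M%:E * 'E_P[Z])%E.
Proof.
move=> mZ bZ mY bY.
have Z1 : Z \in Lfun P 1 by exact: bounded_Lfun1.
have ZY1 : (fun w => Z w * Y w) \in Lfun P 1.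
  by apply: bounded_Lfun1; [exact: measurable_funM | exact: bounded_funM].
have MZ1 : M \o* Z \in Lfun P 1.
  apply: bounded_Lfun1; first exact: measurable_funM.
  by apply: bounded_funM => //; exact: bounded_cst.
have -> : (fun w => Z w * (M - Y w)) = (M \o* Z) \- (fun w => Z w * Y w).
  by apply/funext => w /=; rewrite mulrBr.
by rewrite expectationB// expectationZl// sube_ge0// expectation_fin_num.
Qed.

(** Forward factorization bounds the upper expectation of a product because it
    constrains every [P] with the same constant, the upper expectation of
    [f (X n)]; the sign of [f] makes that constant nonnegative, so that the
    factor depending on [P] may be replaced by its supremum. *)
Lemma forward_factorization_upperM PP (X : nat -> {mfun T >-> R}) (n : nat)
    (f : R -> R) (g : n.-tuple R -> R) :
  PP !=set0 -> forward_factorization PP X ->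
  measurable_fun setT f -> bounded_fun f -> (forall x, 0 <= f x) ->
  measurable_fun setT g -> bounded_fun g -> (forall u, 0 <= g u) ->
  (upper_expectation PP (fun w => (g [tuple X i w | i < n] * f (X n w))%R) <=
   upper_expectation PP (fun w => g [tuple X i w | i < n]) *
   upper_expectation PP (f \o X n))%E.
Proof.
move=> PP0 ff mf bf f0 mg bg g0.
have mfX : measurable_fun setT (f \o X n) by exact: measurableT_comp.
have bfX : bounded_fun (f \o X n) by exact: bounded_fun_comp.
have mX : measurable_fun setT (fun w => [tuple X i w | i < n]).
  apply/measurable_fun_tnthP => i.
  have -> : (tnth (T:=R))^~ i \o (fun w => [tuple X i w | i < n]) = X i.
    by apply/funext => w /=; rewrite tnth_mktuple.
  exact: measurable_funPT.
have mgX : measurable_fun setT (fun w => g [tuple X i w | i < n]).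
  exact: (measurableT_comp mg mX).
have bgX : bounded_fun (fun w => g [tuple X i w | i < n]).
  exact: (bounded_fun_comp (fun w => [tuple X i w | i < n]) bg).
have fX1 P : PP P -> f \o X n \in Lfun P 1.
  by move=> _; exact: bounded_Lfun1.
have finM : upper_expectation PP (f \o X n) \is a fin_num.
  by apply: upper_expectation_fin_num => // x; exact: f0.
have M0 : (0 <= upper_expectation PP (f \o X n))%E.
  by apply: upper_expectation_ge0 => // x; exact: f0.
have bNf : bounded_fun (\- f).
  by apply: bounded_funN.
(* Using [\- f] instead of [f] turns the lower bound into an upper bound. *)
have := ff n (\- f) g (measurable_funN mf) bNf mg bg g0.
have -> : (\- f) \o X n = \- (f \o X n) by [].
rewrite lower_expectation_opp// fineN.
rewrite -(fineK finM) in M0 *; move: (fine _) M0 => M M0 ffM.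
apply: ge_ereal_sup => _ [P PPP <-].
apply: (@le_trans _ _ (M%:E * 'E_P[fun w => g [tuple X i w | i < n]])%E).
  apply: expectationM_le => //.
  apply: le_trans ffM _; apply: ereal_inf_lbound; exists P => //.
  by congr expectation; apply/funext => w /=; rewrite opprK addrC.
by rewrite muleC lee_wpmul2r// expectation_le_upper.
Qed.

End UpperExpectation.

Theorem proposition3p6 (R : realType) (d : measure_display)
    (T : measurableType d) (PP : set (probability T R))
    (PP0 : PP !=set0) (X : nat -> {mfun T >-> R}) :
  forward_factorization PP X -> negatively_associated PP X.
Proof.
move=> ff n f _ Cf _.
have mf i : measurable_fun setT (f i).
  by have [cf _ _] := Cf i; exact: continuous_measurable_fun.
have bf i : bounded_fun (f i) by have [] := Cf i.
have f0 i x : 0 <= f i x by have [_ _] := Cf i.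
pose g (u : n.-tuple R) := \prod_(i < n) f i (tnth u i).
have gX w : g [tuple X i w | i < n] = \prod_(i < n) f i (X i w).
  by apply: eq_bigr => i _; rewrite tnth_mktuple.
under eq_fun do rewrite big_ord_recr/= -gX.
under [in leRHS]eq_fun do rewrite -gX.
apply: forward_factorization_upperM => //.
- apply: measurable_prod => i _.
  exact: measurableT_comp (mf i) (measurable_tnth i).
- apply: bounded_fun_prod => i.
  exact: (bounded_fun_comp (fun u : n.-tuple R => tnth u i) (bf i)).
- by move=> u; apply: prodr_ge0.
Qed.
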